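(* Let $f(x)=x^TAx+2a^Tx+c$ and $h(x)=x^TBx+2b^Tx+d$ be quadratic functions on $\mathbb{R}^n$, where $A,B$ are real symmetric $n\times n$ matrices, $a,b\in\mathbb{R}^n$ and $c,d\in\mathbb{R}$. Suppose $\{x\in\mathbb{R}^n:h(x)=0\}\neq\emptyset$ and that $h$ does not take both positive and negative values (i.e. there are no $x',x''\in\mathbb{R}^n$ with $h(x')<0<h(x'')$). Then the following two statements are equivalent: $(\mathrm{E}_1)$ for all $x\in\mathbb{R}^n$, $h(x)=0$ implies $f(x)\ge 0$; $(\mathrm{E}_2^r)$ for every $\epsilon>0$ there exists $\lambda_\epsilon\in\mathbb{R}$ such that $f(x)+\lambda_\epsilon h(x)+\epsilon(x^Tx+1)\ge 0$ for all $x\in\mathbb{R}^n$. *)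

(* Defs.v *)
From mathcomp Require Import all_boot all_order all_algebra.
From mathcomp Require Import reals.
Import Order.TTheory GRing.Theory Num.Theory.

Set Implicit Arguments.
Unset Strict Implicit.
Unset Printing Implicit Defensive.

Local Open Scope ring_scope.

(* Vectors are columns; [0 0] reads the single entry of a 1 x 1 matrix product. *)
Definition quadratic (R : realType) (n : nat)
    (A : 'M[R]_n) (a : 'cV[R]_n) (c : R) (x : 'cV[R]_n) : R :=
  (x^T *m A *m x) 0 0 + 2 * (a^T *m x) 0 0 + c.

(* Main.v *)
(** If, say, [h >= 0], then [h x = (x - x0)^T B (x - x0)] at any zero [x0] of
    [h], with [B] positive semidefinite. Subtracting from [x] the vector
    [w = B^- B (x - x0)], where [B^-] is a generalized inverse, lands on the
    zero set of [h], so [f (x - w) >= 0]. The terms of [f x - f (x - w)] that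
    are linear in [w] are absorbed by [eps (x^T x + 1)] up to terms quadratic
    in [w], hence in [B (x - x0)], and a positive semidefinite [B] satisfies
    [|B y|^2 <= K y^T B y]; so a large multiple of [h x] dominates them. *)
Require Import Defs.
From mathcomp Require Import all_boot all_order all_algebra.
From mathcomp Require Import reals boolp ring lra.
Import Order.TTheory GRing.Theory Num.Theory.

Local Open Scope ring_scope.

Section Dot.
Context {R : realType} {n : nat}.
Implicit Types (M : 'M[R]_n) (u v w : 'cV[R]_n).

Definition dot u v : R := (u^T *m v) 0 0.

Lemma dotE u v : dot u v = \sum_i u i 0 * v i 0.
Proof. by rewrite /dot mxE; apply: eq_bigr => i _; rewrite mxE. Qed.

Lemma dotC u v : dot u v = dot v u.
Proof. by rewrite !dotE; apply: eq_bigr => i _; rewrite mulrC. Qed.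

Lemma dotDr u v w : dot u (v + w) = dot u v + dot u w.
Proof. by rewrite /dot mulmxDr mxE. Qed.

Lemma dotZr k u v : dot u (k *: v) = k * dot u v.
Proof. by rewrite /dot -scalemxAr mxE. Qed.

Lemma dotDl u v w : dot (u + v) w = dot u w + dot v w.
Proof. by rewrite dotC dotDr !(dotC w). Qed.

Lemma dotZl k u v : dot (k *: u) v = k * dot u v.
Proof. by rewrite dotC dotZr dotC. Qed.

Lemma dot_mulmxl M u v : dot (M *m u) v = dot u (M^T *m v).
Proof. by rewrite /dot trmx_mul mulmxA. Qed.

Lemma dot_ge0 u : 0 <= dot u u.
Proof. by rewrite dotE; apply: sumr_ge0 => i _; rewrite -expr2 sqr_ge0. Qed.

Lemma sqr_le_dot u i : u i 0 ^+ 2 <= dot u u.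
Proof.
rewrite dotE (bigD1 i) //= -expr2 lerDl.
by apply: sumr_ge0 => j _; rewrite -expr2 sqr_ge0.
Qed.

Lemma dot_mulmx_bounded M :
  exists2 K : R, 0 < K & forall v, dot v (M *m v) <= K * dot v v.
Proof.
(* The summand 1 keeps [K] positive even when [M] is zero. *)
exists (1 + \sum_i \sum_j `|M i j|) => [|v].
  by rewrite ltr_pwDl // sumr_ge0 // => i _; apply: sumr_ge0.
rewrite mulrDl mul1r -[leLHS]add0r lerD ?dot_ge0 //.
rewrite dotE mulr_suml ler_sum // => i _.
rewrite mxE mulr_sumr mulr_suml ler_sum // => j _.
rewrite mulrCA (le_trans (ler_norm _)) // normrM ler_wpM2l // ler_norml.
(* The squares of [v i 0 + v j 0] and [v i 0 - v j 0] bound [2 |v_i v_j|] by [v_i^2 + v_j^2], which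
   is at most [2 * dot v v]. *)
have := sqr_le_dot v i; have := sqr_le_dot v j.
have := sqr_ge0 (v i 0 + v j 0); have := sqr_ge0 (v i 0 - v j 0).
by move=> *; apply/andP; split; nra.
Qed.

Lemma psd_sqr_bound M : M^T = M -> (forall v, 0 <= dot v (M *m v)) ->
  exists2 K : R, 0 < K &
    forall v, dot (M *m v) (M *m v) <= K * dot v (M *m v).
Proof.
move=> symM psdM; have [K K0 HK] := dot_mulmx_bounded M.
exists K => // v.
(* Minimizing the form along the gradient direction [M v]. *)
have := psdM (K *: v + -1 *: (M *m v)); have := HK (M *m v).
rewrite mulmxDr -!scalemxAr !(dotDl, dotDr, dotZl, dotZr).
rewrite (_ : dot v (M *m (M *m v)) = dot (M *m v) (M *m v)); last first.
  by rewrite dot_mulmxl symM.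
by move=> ? ?; rewrite -(ler_pM2l K0); lra.
Qed.

Lemma quadraticE (A : 'M[R]_n) a c x :
  quadratic A a c x = dot x (A *m x) + 2 * dot a x + c.
Proof. by rewrite /quadratic /dot mulmxA. Qed.

Lemma quadraticD (A : 'M[R]_n) a c x w : A^T = A ->
  quadratic A a c (x + w) =
  quadratic A a c x + 2 * dot w (A *m x + a) + dot w (A *m w).
Proof.
move=> symA; rewrite !quadraticE mulmxDr !(dotDl, dotDr) (dotC w a).
rewrite (_ : dot x (A *m w) = dot w (A *m x)); last by rewrite dotC dot_mulmxl symA.
by ring.
Qed.

Lemma quadraticN (A : 'M[R]_n) a c x :
  quadratic (- A) (- a) (- c) x = - quadratic A a c x.
Proof.
rewrite !quadraticE mulNmx -!scaleN1r !(dotZl, dotZr).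
by ring.
Qed.

(** A zero of a nonnegative quadratic function is a minimizer, so the linear term of the expansion
    around [x0] vanishes in every direction [y]. *)
Lemma quadratic_at_min_zero (B : 'M[R]_n) b d x0 y : B^T = B ->
  (forall x, 0 <= quadratic B b d x) -> quadratic B b d x0 = 0 ->
  quadratic B b d (x0 + y) = dot y (B *m y).
Proof.
move=> symB h_ge0 h0; rewrite quadraticD // h0 add0r.
set r := dot y _; set p := dot y _.
have H t : 0 <= 2 * t * r + t ^+ 2 * p.
  have := h_ge0 (x0 + t *: y); rewrite quadraticD // h0 -scalemxAr.
  by rewrite !(dotZl, dotZr) add0r -/r -/p mulrA (mulrA t) expr2.
have p0 : 0 <= p by have := H 1; have := H (-1); lra.
suff -> : r = 0 by rewrite mulr0 add0r.
have p1 : p + 1 != 0 by rewrite gt_eqF // ltr_wpDl.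
(* The vertex would be at [- r / p]; the denominator [p + 1] avoids a division by zero and still
   yields a negative value unless [r = 0]. *)
have := H (- r / (p + 1)).
have -> : 2 * (- r / (p + 1)) * r + (- r / (p + 1)) ^+ 2 * p =
  - ((r / (p + 1)) ^+ 2 * (p + 2)) by field.
rewrite oppr_ge0 pmulr_lle0; last by lra.
move=> r2; have /eqP : (r / (p + 1)) ^+ 2 = 0.
  by apply/eqP; rewrite eq_le r2 sqr_ge0.
by rewrite sqrf_eq0 mulf_eq0 invr_eq0 (negPf p1) orbF => /eqP.
Qed.

Lemma regularized_S_lemma_ge0 (A B : 'M[R]_n) a b c d (eps : R) :
  A^T = A -> B^T = B ->
  (exists x, quadratic B b d x = 0) -> (forall x, 0 <= quadratic B b d x) ->
  (forall x, quadratic B b d x = 0 -> 0 <= quadratic A a c x) -> 0 < eps ->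
  exists lambda : R, forall x,
    0 <= quadratic A a c x + lambda * quadratic B b d x + eps * (dot x x + 1).
Proof.
move=> symA symB [x0 h0] h_ge0 E1 eps0.
have hE y := quadratic_at_min_zero B b d x0 y symB h_ge0 h0.
have [K K0 HK] : exists2 K : R, 0 < K &
    forall v, dot (B *m v) (B *m v) <= K * dot v (B *m v).
  by apply: psd_sqr_bound => // v; rewrite -hE.
have [P BPB] : exists P, B *m P *m B = B.
  by exists (pinvmx B); rewrite mulmxKpV.
(* At [v = B y], the form of [M] collects, for [w = P v], the terms [|A w|^2], [(a^T w)^2] and
   [eps w^T A w] left over once the squares below are completed. *)
pose M := P^T *m (A^T *m A + a *m a^T + eps *: A) *m P.
have [L L0 HL] := dot_mulmx_bounded M.
have MP v : dot v (M *m v) = dot (A *m (P *m v)) (A *m (P *m v))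
    + dot a (P *m v) ^+ 2 + eps * dot (P *m v) (A *m (P *m v)).
  rewrite -!mulmxA -dot_mulmxl.
  rewrite !mulmxDl !dotDr -scalemxAl dotZr -!mulmxA -dot_mulmxl.
  congr (_ + _ + _).
  by rewrite {1}/dot mulmxA mxE big_ord1 -/(dot (P *m v) a) dotC expr2.
exists (L * K / eps) => x; pose y := x - x0; pose w := P *m (B *m y).
have Bw : B *m (y - w) = 0 by rewrite mulmxBr !mulmxA BPB subrr.
have fw : 0 <= quadratic A a c (x + -1 *: w).
  apply: E1; have -> : x + -1 *: w = x0 + (y - w).
    by rewrite scaleN1r /y addrA [x0 + _]addrC subrK.
  by rewrite hE Bw /dot mulmx0 mxE.
have hx : quadratic B b d x = dot y (B *m y) by rewrite -hE /y addrC subrK.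
(* [L] bounds the form of [M] by [L |B y|^2], and [K] bounds [|B y|^2] by [K h x]. *)
have Hw : dot (A *m w) (A *m w) + dot a w ^+ 2 + eps * dot w (A *m w)
    <= L * (K * dot y (B *m y)).
  by rewrite -MP (le_trans (HL _)) // ler_pM2l.
move: fw; rewrite quadraticD // -scalemxAr !(dotZl, dotZr, dotDr) (dotC w a).
(* After multiplication by [eps], this square and that of [eps + dot a w] absorb the cross terms
   [2 eps w^T A x] and [2 eps a^T w] into [eps^2 (x^T x + 1)], at the cost of the terms bounded in
   [Hw]. *)
have := dot_ge0 (eps *: x + A *m w); rewrite !(dotDl, dotDr, dotZl, dotZr).
rewrite (dotC x) dot_mulmxl symA.
have := sqr_ge0 (eps + dot a w).
rewrite hx => S1 S2 fw; rewrite -(pmulr_rge0 _ eps0) 2!mulrDr.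
rewrite [eps * (_ / _ * _)](_ : _ = L * (K * dot y (B *m y))); last first.
  by field; rewrite gt_eqF.
have := mulr_ge0 (ltW eps0) fw.
by move: S1 S2 Hw; lra.
Qed.

End Dot.

Theorem theorem2 (R : realType) (n : nat)
    (A B : 'M[R]_n) (a b : 'cV[R]_n) (c d : R)
    (symA : A^T = A) (symB : B^T = B)
    (h_zero : exists x : 'cV[R]_n, quadratic B b d x = 0)
    (h_one_sign : ~ exists x' x'' : 'cV[R]_n,
        quadratic B b d x' < 0 /\ 0 < quadratic B b d x'') :
  (forall x : 'cV[R]_n, quadratic B b d x = 0 -> 0 <= quadratic A a c x)
  <->
  (forall eps : R, 0 < eps ->
     exists lambda : R, forall x : 'cV[R]_n,
       0 <= quadratic A a c x + lambda * quadratic B b d x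
            + eps * ((x^T *m x) 0 0 + 1)).
Proof.
split=> [E1 eps eps0 | E2 x hx]; last first.
  have x1 : 0 < dot x x + 1 by rewrite ltr_wpDl ?dot_ge0.
  apply/ler_addgt0Pr => e e0.
  (* At a zero of [h] the multiplier disappears, and this choice of epsilon makes the regularizing
     term exactly [e]. *)
  have [l /(_ x)] := E2 (e / (dot x x + 1)) (divr_gt0 e0 x1).
  by rewrite hx mulr0 addr0 -/(dot x x) divfK // gt_eqF.
have [[x' hx']|h_ge0] := pselect (exists x', quadratic B b d x' < 0).
  (* A negative value forces [h <= 0] everywhere, so the nonnegative case applies to [- h], with the
     multiplier changing sign. *)
  have [||x|x|l Hl] := regularized_S_lemma_ge0 A (- B) a (- b) c (- d) eps
    symA _ _ _ _ eps0.
  - by rewrite linearN /= symB.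
  - by have [z hz] := h_zero; exists z; rewrite quadraticN hz oppr0.
  - rewrite quadraticN oppr_ge0 leNgt; apply/negP => hx.
    by apply: h_one_sign; exists x', x.
  - by rewrite quadraticN => /eqP; rewrite oppr_eq0 => /eqP /E1.
  by exists (- l) => x; have := Hl x; rewrite quadraticN mulrN mulNr.
apply: regularized_S_lemma_ge0 => // x.
by rewrite leNgt; apply/negP => hx; apply: h_ge0; exists x.
Qed.
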